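(* Let $(a_{ijk})_{1\le i,j,k\le s}$ and $(b_{ij})_{1\le i,j\le s}$ be the real coefficients of an $s$-stage NPRK method. The method has order $p$ if and only if $$\Phi(\tau)=\frac{1}{\gamma(\tau)}$$ for all edge-colored rooted trees $\tau$ (with edge colors in $\{1,2\}$) such that $|\tau|\le p$.
   Context: **NPRK method.** Let $X$ be a finite-dimensional real vector space, $F:X\times X\to X$ smooth, and consider the initial value problem $y'=F(y,y)$, $y(t_0)=y_0$. An $s$-stage nonlinearly partitioned Runge--Kutta (NPRK) method with real coefficients $a_{ijk}$, $b_{ij}$ ($i,j,k\in\{1,\dots,s\}$) and step size $h$ is $$Y_i=y_n+h\sum_{j=1}^s\sum_{k=1}^s a_{ijk}F(Y_j,Y_k)\quad(i=1,\dots,s),\qquad y_{n+1}=y_n+h\sum_{i=1}^s\sum_{j=1}^s b_{ij}F(Y_i,Y_j).$$ For small $h$ the stages $Y_i=Y_i(h)$ are the solution of the stage equations near $y_n$ (with $Y_i(0)=y_n$). **Order.** The method has order $p$ if, for every such $X$, $F$, $t_0$, $y_0$, the numerical solution $y_1$ after one step of size $h$ from $y_0$ satisfies $y_1-y(t_0+h)=\mathcal{O}(h^{p+1})$ as $h\to0$, where $y$ is the exact solution. Equivalently, the Taylor expansions in $h$ at $h=0$ of $y_1$ and $y(t_0+h)$ agree up to and including the $h^p$ term. **Edge-colored rooted trees.** These are finite rooted trees in which each edge has a color in $\{1,2\}$, up to equivalence (the order in which children are listed is irrelevant). Recursively: the single node $\bullet$ is a tree, and if $\tau_1,\dots,\tau_m$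 ($m\ge1$) are trees and $a_1,\dots,a_m\in\{1,2\}$, then $\tau=[\tau_1|_{a_1},\dots,\tau_m|_{a_m}]$ is the tree obtained by joining the root of each $\tau_l$ to a new root by an edge of color $a_l$. Lists differing by a permutation of the pairs $(\tau_l,a_l)$ define the same tree. The order $|\tau|$ is the number of nodes of $\tau$. The density is $\gamma(\bullet)=1$, $\gamma(\tau)=|\tau|\,\gamma(\tau_1)\cdots\gamma(\tau_m)$ for $\tau=[\tau_1|_{a_1},\dots,\tau_m|_{a_m}]$. **Elementary weights.** The indexed elementary weights $\phi_{i_1i_2}(\tau)$, $i_1,i_2\in\{1,\dots,s\}$, are given by $\phi_{i_1i_2}(\bullet)=1$ and, for $\tau=[\tau_1|_{a_1},\dots,\tau_m|_{a_m}]$, $$\phi_{i_1i_2}(\tau)=\prod_{l=1}^m\Big(\sum_{u,v=1}^s a_{i_{a_l}uv}\,\phi_{uv}(\tau_l)\Big),$$ i.e. each non-root node is labeled by a pair of indices $uv$, and an edge of color $1$ (resp. $2$) from a lower node labeled $kl$ to an upper node labeled $uv$ contributes the factor $a_{kuv}$ (resp. $a_{luv}$), with summation over all non-root indices. The elementary weight is $\Phi(\tau)=\sum_{i,j=1}^s b_{ij}\phi_{ij}(\tau)$. *)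

(* Defs.v *)
From HB Require Import structures.
From mathcomp Require Import all_boot all_order all_algebra.
From mathcomp Require Import all_classical all_reals all_analysis.

Set Implicit Arguments.
Unset Strict Implicit.
Unset Printing Implicit Defensive.

Import Order.TTheory GRing.Theory Num.Theory.
Import numFieldNormedType.Exports.
Local Open Scope classical_set_scope.
Local Open Scope ring_scope.

Inductive color := Color1 | Color2.

(* [Node [:: (t1, a1); ...; (tm, am)]] is [t1|_a1, ..., tm|_am], and
   [Node [::]] is the single node.  Elements of [ectree] are ordered
   representatives: edge-colored rooted trees are the classes of [ectree_equiv]
   below, and [ectree_order], [density] and [Phi] are constant on these classes
   (lemmas [*_equiv]), so that quantifying over representatives amounts to
   quantifying over trees. *)
Inductive ectree := Node of seq (ectree * color).

Inductive ectree_equiv : ectree -> ectree -> Prop :=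
| Equiv_refl t : ectree_equiv t t
| Equiv_trans t u v : ectree_equiv t u -> ectree_equiv u v -> ectree_equiv t v
| Equiv_swap l x y r :
    ectree_equiv (Node (l ++ x :: y :: r)) (Node (l ++ y :: x :: r))
| Equiv_child l t t' a r : ectree_equiv t t' ->
    ectree_equiv (Node (l ++ (t, a) :: r)) (Node (l ++ (t', a) :: r)).

Fixpoint ectree_order (t : ectree) : nat :=
  let: Node l := t in (\sum_(n <- [seq ectree_order c.1 | c <- l]) n).+1%N.

(* For the single node the product is empty and the value is 1. *)
Fixpoint density (t : ectree) : nat :=
  let: Node l := t in
  (ectree_order t * \prod_(n <- [seq density c.1 | c <- l]) n)%N.

Definition pick_index (I : Type) (c : color) (i1 i2 : I) : I :=
  match c with Color1 => i1 | Color2 => i2 end.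

Fixpoint phi (R : realType) (s : nat) (a : 'I_s -> 'I_s -> 'I_s -> R)
    (t : ectree) (i1 i2 : 'I_s) : R :=
  let: Node l := t in
  \prod_(x <- [seq \sum_(u < s) \sum_(v < s)
                     a (pick_index c.2 i1 i2) u v * phi a c.1 u v | c <- l]) x.

Definition Phi (R : realType) (s : nat) (a : 'I_s -> 'I_s -> 'I_s -> R)
    (b : 'I_s -> 'I_s -> R) (t : ectree) : R :=
  \sum_(i < s) \sum_(j < s) b i j * phi a t i j.

Lemma ectree_order_equiv t u :
  ectree_equiv t u -> ectree_order t = ectree_order u.
Proof.
elim=> {t u} [//|t u v _ -> _ -> //|l x y r|l t t' a r _ IH] /=.
  by rewrite !big_map !big_cat !big_cons /= (addnCA (ectree_order x.1)).
by rewrite !big_map !big_cat !big_cons /= IH.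
Qed.

Lemma density_equiv t u : ectree_equiv t u -> density t = density u.
Proof.
elim=> {t u} [//|t u v _ -> _ -> //|l x y r|l t t' a r tt' IH].
  rewrite /density -/density (ectree_order_equiv (Equiv_swap l x y r)).
  by rewrite !big_map !big_cat !big_cons /= (mulnCA (density x.1)).
rewrite /density -/density (ectree_order_equiv (Equiv_child l a r tt')).
by rewrite !big_map !big_cat !big_cons /= IH.
Qed.

Lemma phi_equiv (R : realType) (s : nat) (a : 'I_s -> 'I_s -> 'I_s -> R) t u :
  ectree_equiv t u -> phi a t =2 phi a u.
Proof.
elim=> {t u} [//|t u v _ tu _ uv i j|l x y r i j|l t t' c r _ IH i j] /=.
- by rewrite tu uv.
- by rewrite !big_map !big_cat !big_cons /=; congr (_ * _); rewrite mulrCA.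
rewrite !big_map !big_cat !big_cons /=; congr (_ * (_ * _)).
by do 2!(apply: eq_bigr => ? _); rewrite IH.
Qed.

Lemma Phi_equiv (R : realType) (s : nat) (a : 'I_s -> 'I_s -> 'I_s -> R)
    (b : 'I_s -> 'I_s -> R) t u : ectree_equiv t u -> Phi a b t = Phi a b u.
Proof.
by move=> tu; do 2!(apply: eq_bigr => ? _); rewrite (phi_equiv a tu).
Qed.

(* A finite-dimensional real vector space is rendered as a normed module with a
   finite spanning family: the choice of the norm is immaterial, since all norms
   on such a space are equivalent. *)
Definition finite_dimensional (R : realType) (X : normedModType R) : Prop :=
  exists (n : nat) (e : 'I_n -> X),
    forall x : X, exists c : 'I_n -> R, x = \sum_(i < n) c i *: e i.

(* Used for finite-dimensional [V], where regularity of the differential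
   [x |-> 'd f x], as a map into the linear maps [V -> W], amounts to that of
   [x |-> 'd f x v] for every [v]. *)
Fixpoint class_C (R : realType) (V W : normedModType R) (k : nat)
    (f : V -> W) : Prop :=
  match k with
  | 0 => continuous f
  | k'.+1 => (forall x, differentiable f x) /\
             (forall v, class_C k' (fun x => 'd f x v))
  end.

Definition smooth (R : realType) (V W : normedModType R) (f : V -> W) : Prop :=
  forall k : nat, class_C k f.

Definition exact_solution (R : realType) (X : normedModType R)
    (F : X * X -> X) (t0 : R) (y0 : X) (y : R -> X) : Prop :=
  y t0 = y0 /\ \forall t \near t0, is_derive (t : R) (1 : R) y (F (y t, y t)).

(* By local uniqueness, continuity at [0] singles out the germ at [h = 0] of the
   solution of the stage equations near [y0]. *)
Definition stage_solution (R : realType) (s : nat)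
    (a : 'I_s -> 'I_s -> 'I_s -> R) (X : normedModType R)
    (F : X * X -> X) (y0 : X) (Y : 'I_s -> R -> X) : Prop :=
  (forall i, Y i 0 = y0 /\ {for 0, continuous (Y i)}) /\
  \forall h \near (0 : R), forall i,
    Y i h = y0 + h *: \sum_(j < s) \sum_(k < s) a i j k *: F (Y j h, Y k h).

Definition nprk_step (R : realType) (s : nat) (b : 'I_s -> 'I_s -> R)
    (X : normedModType R) (F : X * X -> X) (y0 : X) (Y : 'I_s -> R -> X)
    (h : R) : X :=
  y0 + h *: \sum_(i < s) \sum_(j < s) b i j *: F (Y i h, Y j h).

Definition nprk_has_order (R : realType) (s : nat)
    (a : 'I_s -> 'I_s -> 'I_s -> R) (b : 'I_s -> 'I_s -> R) (p : nat) : Prop :=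
  forall (X : normedModType R) (F : X * X -> X) (t0 : R) (y0 : X)
         (y : R -> X) (Y : 'I_s -> R -> X),
    finite_dimensional X -> smooth F ->
    exact_solution F t0 y0 y -> stage_solution a F y0 Y ->
    (fun h : R => nprk_step b F y0 Y h - y (t0 + h))
      =O_ (0 : R) (fun h : R => h ^+ p.+1).

(* Main.v *)
From HB Require Import structures.
Require Import Defs.
From mathcomp Require Import all_boot all_order all_algebra.
From mathcomp Require Import all_classical all_reals all_analysis.
From mathcomp Require Import ring lra.

(** Both the exact solution and the numerical one have expansions indexed by
    trees.  Let [E t] be the elementary differential of an ordered tree [t]: for
    the tree with colored subtrees [(t_1, a_1), ..., (t_m, a_m)] it is [1 / m!]
    times the [m]-th derivative of [F] at [(y0, y0)] along the vectors [E t_l]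
    placed in the factor [a_l] of [X * X].  If two curves are expanded as
    [y0 + \sum_t h ^ |t| c_a(t) E t] for [a = 1, 2], then Taylor's formula and
    multilinearity expand [F] along them as
    [\sum_t h ^ (|t| - 1) (\prod_l c_{a_l}(t_l)) E t]
    ([bseries_composition]).  Working with ordered trees makes this a plain
    expansion of a product of sums, free of symmetry coefficients.

    Inserting this into the differential equation and integrating, respectively
    into the stage equations, gains one order at each round.  By induction the
    exact solution has the coefficients [1 / density t] ([exact_bseries]) and
    one step of the method has the coefficients [Phi a b t]
    ([nprk_step_bseries]).  If these agree for all trees with at most [p] nodes,
    the difference is [O(h ^ (p + 1))].

    Conversely, for a given tree consider the system with one unknown for each
    subtree, whose derivative is the product of the unknowns of the children,
    each taken in the argument of [F] selected by the color of its edge.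
    Starting from zero, the unknown of [t] is exactly [h ^ |t| / density t] for
    the exact solution and [h ^ |t| * Phi a b t] after one step of the method
    ([tree_exact_solution], [tree_quadrature]).  So order [p] forces the
    equality of the two coefficients when [|t| <= p]. *)

Set Implicit Arguments.
Unset Strict Implicit.
Unset Printing Implicit Defensive.

Import Order.TTheory GRing.Theory Num.Theory.
Import numFieldNormedType.Exports.
Local Open Scope classical_set_scope.
Local Open Scope ring_scope.

(** * Coordinates in finite-dimensional normed spaces *)

Section Coordinates.
Variables (R : realType) (X : normedModType R).

(** A spanning family of minimal size is free: a nontrivial relation would
    express one of its vectors in terms of the others. *)
Lemma finite_dimensional_basis : finite_dimensional X ->
  exists (n : nat) (e : 'I_n -> X),
    (forall x, exists c : 'I_n -> R, x = \sum_(i < n) c i *: e i) /\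
    (forall c : 'I_n -> R, \sum_(i < n) c i *: e i = 0 -> forall i, c i = 0).
Proof.
move=> fdX.
pose spanned n := `[< exists e : 'I_n -> X,
  forall x, exists c : 'I_n -> R, x = \sum_(i < n) c i *: e i >].
have ex_spanned : exists n, spanned n.
  by case: fdX => n fdX; exists n; exact/asboolP.
have [n /asboolP[e span_e] n_min] := ex_minnP ex_spanned.
exists n, e; split=> // c c0 j; apply: contrapT => /eqP cj0.
case: n => [|n] in e span_e n_min c c0 j cj0 *; first by case: j {cj0}.
suff /n_min : spanned n by rewrite ltnn.
apply/asboolP; exists (e \o lift j) => x; have [d ->] := span_e x.
exists (fun i => d (lift j i) - d j / c j * c (lift j i)).
move: c0; rewrite (bigD1_ord j)//= (bigD1_ord j (P := xpredT))//=.
move/eqP; rewrite addr_eq0 => /eqP ej.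
have -> : e j = - ((c j)^-1 *: \sum_(i < n) c (lift j i) *: e (lift j i)).
  by rewrite -scalerN -ej scalerA mulVf// scale1r.
rewrite scalerN scalerA scaler_sumr addrC -sumrB; apply: eq_bigr => i _.
by rewrite scalerA scalerBl.
Qed.

(** The coordinates in a basis are bounded because the norm of a combination
    attains a positive minimum on the compact unit sphere of the space of
    coefficients, by freeness.  This is where finite dimension is used: it turns
    bounds on the derivatives along finitely many basis vectors into bounds that
    are uniform in the direction, and reduces vector-valued mean value estimates
    to scalar ones. *)
Lemma bounded_coordinates : finite_dimensional X ->
  exists (n : nat) (e : 'I_n -> X) (c : 'I_n -> {linear X -> R}) (C : R),
    [/\ 0 <= C, forall x, x = \sum_(i < n) c i x *: e i
      & forall i x, `|c i x| <= C * `|x|].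
Proof.
move=> /finite_dimensional_basis[n [e [span_e free_e]]].
pose f (v : 'rV[R]_n) : X := \sum_(i < n) v ord0 i *: e i.
have fZ k v : f (k *: v) = k *: f v.
  by rewrite /f scaler_sumr; apply: eq_bigr => i _; rewrite mxE scalerA.
have f_inj v : f v = 0 -> v = 0.
  by move=> /free_e v0; apply/rowP => i; rewrite v0 mxE.
have f_cont : continuous f.
  apply: continuous_big => [|i _ v]; first exact: add_continuous.
  by apply: continuousZr_tmp; exact: coord_continuous.
have [C C0 f_bound] : exists2 C, 0 <= C & forall v, `|v| <= C * `|f v|.
  pose S := [set v : 'rV[R]_n | `|v| = 1].
  have [S0|/set0P/negP/negPn/eqP S0] := pselect (S !=set0); last first.
    exists 0 => // v; rewrite mul0r; have [->|v0] := eqVneq v 0.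
      by rewrite normr0.
    suff : S (`|v|^-1 *: v) by rewrite S0.
    by rewrite /S /= normrZ normfV normr_id mulVf// normr_eq0.
  have cS : compact S.
    apply: bounded_closed_compact.
      by exists 1; split => // M M1 v /= ->; exact: ltW.
    apply: (@closed_comp _ _ (fun v : 'rV[R]_n => `|v|) [set 1]).
      by move=> v _; exact: norm_continuous.
    exact: closed_eq.
  have [|v0] := @EVT_min_rV R n (fun v => `|f v|) S S0 cS.
    apply: continuous_subspaceT => v.
    by apply: continuous_comp; [exact: f_cont|exact: norm_continuous].
  rewrite inE => Sv0 v0min.
  have fv0 : 0 < `|f v0|.
    rewrite normr_gt0; apply/eqP => /f_inj v00; move: Sv0.
    by rewrite /S /= v00 normr0 => /eqP; rewrite eq_sym oner_eq0.
  exists `|f v0|^-1 => [|v]; first by rewrite invr_ge0 ltW.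
  have [->|vn0] := eqVneq v 0; first by rewrite normr0 mulr_ge0// invr_ge0 ltW.
  rewrite ler_pdivlMl// -ler_pdivlMr ?normr_gt0// mulrC.
  apply: le_trans (v0min (`|v|^-1 *: v) _) _.
    by rewrite inE /S /= normrZ normfV normr_id mulVf// normr_eq0.
  by rewrite fZ normrZ normfV normr_id.
have [c cE] : {c : X -> 'I_n -> R & forall x, x = \sum_(i < n) c x i *: e i}.
  exact: (@choice X ('I_n -> R) (fun x c => x = \sum_(i < n) c i *: e i)).
have c_lin i : linear (c^~ i : X -> R^o).
  move=> k x y /=; apply/eqP; rewrite -subr_eq0; apply/eqP.
  apply: (free_e (fun i => c (k *: x + y) i - (k * c x i + c y i))).
  under eq_bigr do rewrite scalerBl scalerDl -scalerA.
  by rewrite sumrB big_split/= -scaler_sumr -!cE subrr.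
pose cl i : {linear X -> R^o} :=
  HB.pack (c^~ i : X -> R^o) (GRing.isLinear.Build R X R^o _ _ (c_lin i)).
exists n, e, cl, C; split=> // i x; rewrite {2}(cE x).
have := f_bound (\row_j c x j).
rewrite /f; under [X in _ <= _ * `|X|]eq_bigr do rewrite mxE.
apply: le_trans; rewrite /Num.norm/= mx_normrE.
by rewrite (le_trans _ (le_bigmax _ _ (ord0, i)))//= mxE.
Qed.

End Coordinates.

Lemma finite_dimensional_prod (R : realType) (V W : normedModType R) :
  finite_dimensional V -> finite_dimensional W ->
  finite_dimensional (V * W)%type.
Proof.
move=> [m [e span_e]] [n [f span_f]].
exists (m + n)%N, (fun i => match fintype.split i with
  | inl j => (e j, 0) | inr j => (0, f j) end).
move=> [x y]; have [c ->] := span_e x; have [d ->] := span_f y.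
exists (fun i => match fintype.split i with inl j => c j | inr j => d j end).
rewrite big_split_ord/=.
under [X in _ = X + _]eq_bigr => i _ do rewrite (unsplitK (inl i)).
under [X in _ = _ + X]eq_bigr => i _ do rewrite (unsplitK (inr i)).
have pair0r (k : 'I_m -> R) : (\sum_(i < m) k i *: e i, 0) =
    \sum_(i < m) k i *: ((e i, 0) : V * W).
  rewrite (big_morph (fun x => (x, 0) : V * W) (id1 := 0) (op1 := +%R))//.
    by apply: eq_bigr => i _; congr pair => /=; rewrite scaler0.
  by move=> u v; congr pair => /=; rewrite addr0.
have pair0l (k : 'I_n -> R) : (0, \sum_(i < n) k i *: f i) =
    \sum_(i < n) k i *: ((0, f i) : V * W).
  rewrite (big_morph (fun y => (0, y) : V * W) (id1 := 0) (op1 := +%R))//.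
    by apply: eq_bigr => i _; congr pair => /=; rewrite scaler0.
  by move=> u v; congr pair => /=; rewrite addr0.
by rewrite -(pair0r c) -(pair0l d); congr pair; rewrite /= ?addr0 ?add0r.
Qed.

(** * Iterated directional derivatives *)

Section IteratedDerivatives.
Variables (R : realType) (V W : normedModType R).
Implicit Types (f g : V -> W) (x v : V) (vs : seq V) (k : R).

Lemma smooth_differentiable f x : smooth f -> differentiable f x.
Proof. by move=> /(_ 1)[df _]. Qed.

Lemma smooth_continuous f : smooth f -> continuous f.
Proof. by move=> /(_ 0). Qed.

Lemma smooth_diff f v : smooth f -> smooth (fun x => 'd f x v).
Proof. by move=> sf n; have [_] := sf n.+1; exact. Qed.

Lemma differentiable_lincomb f g x k :
  differentiable f x -> differentiable g x ->
  differentiable (fun y => k *: f y + g y) x.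
Proof.
move=> df dg; apply: (@differentiableD _ _ _ (k *: f) g) => //.
exact: differentiableZ.
Qed.

Lemma diff_lincomb f g x v k : differentiable f x -> differentiable g x ->
  'd (fun y => k *: f y + g y) x v = k *: 'd f x v + 'd g x v.
Proof.
move=> df dg; have dkf : differentiable (k *: f) x by exact: differentiableZ.
apply: etrans (congr1 (fun L : V -> W => L v) (diffD dkf dg)) _.
by congr (_ + _); exact: (congr1 (fun L : V -> W => L v) (diffZ k df)).
Qed.

Lemma class_C_lincomb n f g k : class_C n f -> class_C n g ->
  class_C n (fun x => k *: f x + g x).
Proof.
elim: n f g => [|n IH] f g /=.
  by move=> cf cg x; apply: cvgD; [apply: cvgZl_tmp; exact: cf|exact: cg].
move=> [df cf] [dg cg]; split=> [x|v]; first exact: differentiable_lincomb.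
under eq_fun do rewrite diff_lincomb//.
exact: IH.
Qed.

Lemma class_C_cst n (w : W) : class_C n (fun _ : V => w).
Proof.
elim: n w => [|n IH] w /=; first exact: cst_continuous.
split=> [x|v]; first exact: differentiable_cst.
by under eq_fun do rewrite (diff_cst w)/=; exact: IH.
Qed.

Lemma class_C_sum n (I : Type) (r : seq I) (k : I -> R) (f : I -> V -> W) :
  (forall i, class_C n (f i)) ->
  class_C n (fun x => \sum_(i <- r) k i *: f i x).
Proof.
move=> cf; elim: r => [|i r IH].
  by under eq_fun do rewrite big_nil; exact: class_C_cst.
by under eq_fun do rewrite big_cons; exact: class_C_lincomb.
Qed.

Fixpoint iter_diff f vs : V -> W :=
  if vs is v :: vs' then iter_diff (fun x => 'd f x v) vs' else f.

Lemma iter_diff_lincomb f g k vs x : smooth f -> smooth g ->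
  iter_diff (fun y => k *: f y + g y) vs x =
  k *: iter_diff f vs x + iter_diff g vs x.
Proof.
elim: vs f g => [//|v vs IH] f g sf sg /=.
have -> : (fun y => 'd (fun z => k *: f z + g z) y v) =
          (fun y => k *: 'd f y v + 'd g y v).
  by apply/funext => y; apply: diff_lincomb; exact: smooth_differentiable.
by apply: IH; exact: smooth_diff.
Qed.

Lemma iter_diff0 vs x : iter_diff (fun=> 0) vs x = 0.
Proof.
elim: vs => [//|v vs IH] /=.
by under eq_fun do rewrite (diff_cst (0 : W))/=; exact: IH.
Qed.

Lemma iter_diff_sum (I : Type) (r : seq I) (k : I -> R) (f : I -> V -> W) vs x :
  (forall i, smooth (f i)) ->
  iter_diff (fun y => \sum_(i <- r) k i *: f i y) vs x =
  \sum_(i <- r) k i *: iter_diff (f i) vs x.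
Proof.
move=> sf; elim: r => [|i r IH].
  rewrite big_nil -[RHS](iter_diff0 vs x); congr iter_diff.
  by apply/funext => y; rewrite big_nil.
rewrite big_cons -IH -iter_diff_lincomb//; last first.
  by move=> n; apply: class_C_sum => j; exact: sf.
by congr iter_diff; apply/funext => y; rewrite big_cons.
Qed.

Lemma diff_sum_dir (I : Type) (r : seq I) (k : I -> R) (v : I -> V) f :
  (fun x => 'd f x (\sum_(i <- r) k i *: v i)) =
  (fun x => \sum_(i <- r) k i *: 'd f x (v i)).
Proof.
apply/funext => x; rewrite linear_sum; apply: eq_bigr => i _.
by rewrite linearZ.
Qed.

Fixpoint words (I : Type) (m : nat) (r : seq I) : seq (seq I) :=
  if m is m'.+1 then [seq i :: l | i <- r, l <- words m' r] else [:: [::]].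

(** Expanding the iterated derivative along a linear combination by
    multilinearity indexes the terms by words.  Keeping the words ordered avoids
    any appeal to the symmetry of higher derivatives and the symmetry
    coefficients of unordered trees. *)
Lemma iter_diff_multilinear (I : Type) (r : seq I) (k : I -> R) (v : I -> V)
    m f x : smooth f ->
  iter_diff f (nseq m (\sum_(i <- r) k i *: v i)) x =
  \sum_(l <- words m r) (\prod_(i <- l) k i) *: iter_diff f (map v l) x.
Proof.
elim: m f => [|m IH] f sf /=; first by rewrite big_seq1 big_nil scale1r.
rewrite diff_sum_dir iter_diff_sum; last by move=> i; exact: smooth_diff.
rewrite big_allpairs_dep; apply: eq_bigr => i _.
rewrite IH; last exact: smooth_diff.
by rewrite scaler_sumr; apply: eq_bigr => l _; rewrite big_cons scalerA.
Qed.

Lemma iter_diff_scale k m v f x : smooth f ->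
  iter_diff f (nseq m (k *: v)) x = k ^+ m *: iter_diff f (nseq m v) x.
Proof.
elim: m f => [|m IH] f sf /=; first by rewrite expr0 scale1r.
rewrite IH; last exact: smooth_diff.
rewrite exprSr -scalerA; congr (_ *: _).
have := @diff_sum_dir unit [:: tt] (fun=> k) (fun=> v) f.
rewrite big_seq1 => ->; rewrite iter_diff_sum ?big_seq1// => _.
exact: smooth_diff.
Qed.

End IteratedDerivatives.

(** * Derivatives of curves and the mean value inequality *)

Section Curves.
Variables (R : realType).

Lemma is_derive_line (V W : normedModType R) (f : V -> W) z w (t : R) :
  differentiable f (z + t *: w) ->
  is_derive t (1 : R) (fun u : R => f (z + u *: w)) ('d f (z + t *: w) w).
Proof.
move=> df.
have dl : is_diff t (fun u : R => z + u *: w) ( *:%R^~ w).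
  have := is_diffD (is_diff_cst z t) (is_diff_scalel t w).
  by rewrite add0r.
have [dcomp valcomp] : is_diff t (f \o (fun u : R => z + u *: w))
    ('d f (z + t *: w) \o ( *:%R^~ w)).
  by apply: is_diff_comp; exact: differentiableP.
apply: DeriveDef; first exact/derivable1_diffP.
apply: etrans (deriveE (1 : R) dcomp) _.
by rewrite valcomp /= scale1r.
Qed.

Lemma is_derive_translate (W : normedModType R) (f : R -> W) (c t : R) (d : W) :
  is_derive (c + t) (1 : R) f d -> is_derive t (1 : R) (fun u => f (c + u)) d.
Proof.
move=> [/derivable1_diffP df <-].
have cE (u : R) : c + u *: (1 : R) = c + u by rewrite /GRing.scale/= mulr1.
have := @is_derive_line _ _ f c (1 : R) t; rewrite cE => /(_ df).
under eq_fun do rewrite cE.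
by move=> dline; apply: is_derive_eq dline _; exact/esym/(deriveE (1 : R) df).
Qed.

Lemma is_derive_dilate (W : normedModType R) (f : R -> W) (h t : R) (d : W) :
  is_derive (t *: h) (1 : R) f d ->
  is_derive t (1 : R) (fun u : R => f (u *: h)) (h *: d).
Proof.
move=> [/derivable1_diffP df <-].
have := @is_derive_line _ _ f 0 h t; rewrite add0r => /(_ df).
under eq_fun do rewrite add0r.
move=> dline; apply: is_derive_eq dline _.
by rewrite (deriveE (1 : R) df) -linearZ /GRing.scale/= mulr1.
Qed.

Lemma is_derive_monomial n (t : R) :
  is_derive t (1 : R) (fun u : R => u ^+ n) (n%:R * t ^+ n.-1).
Proof.
have := is_deriveX n (is_derive_id t (1 : R)).
by rewrite exprfctE /GRing.scale/= mulr1.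
Qed.

Lemma is_derive_monomialZ (W : normedModType R) n (w : W) (t : R) :
  is_derive t (1 : R) (fun u : R => u ^+ n *: w) ((n%:R * t ^+ n.-1) *: w).
Proof.
have [/derivable1_diffP d1 d2] := is_derive_monomial n t.
have d3 := @differentiableZl _ _ _ (fun u : R => u ^+ n) w _ d1.
apply: DeriveDef; first exact/derivable1_diffP.
by rewrite deriveE// (diffZl w d1) -deriveE// d2.
Qed.

End Curves.

Section MeanValue.
Variables (R : realType) (W : normedModType R).
Hypothesis fdW : finite_dimensional W.

(** The scalar mean value theorem in each coordinate loses only a constant. *)
Lemma mean_value_inequality : exists2 K : R, 0 <= K &
  forall (f f' : R -> W) (M : R),
    (forall t : R, t \in `[0, 1] -> is_derive t (1 : R) f (f' t)) ->
    (forall t : R, t \in `[0, 1] -> `|f' t| <= M) ->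
    `|f 1 - f 0| <= K * M.
Proof.
have [n [e [c [C [C0 cE c_bound]]]]] := bounded_coordinates fdW.
exists (\sum_(i < n) C * `|e i|).
  by apply: sumr_ge0 => i _; exact: mulr_ge0.
move=> f f' M df f'M.
have c_cont i : continuous (c i).
  apply/linear_bounded_continuous/bounded_funP => r.
  exists (C * r) => x xr; apply: le_trans (c_bound i x) _.
  exact: ler_wpM2l.
rewrite [f 1 - f 0]cE mulr_suml.
apply: le_trans (ler_norm_sum _ _ _) _; apply: ler_sum => i _.
rewrite normrZ mulrAC ler_wpM2r//.
have dcf (t : R) : t \in `[0, 1] -> is_derive t (1 : R) (c i \o f) (c i (f' t)).
  move=> /df[dft <-].
  have /derivable1_diffP dft' := dft.
  apply: DeriveDef.
    apply/derivable1_diffP/differentiable_comp => //.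
    exact: linear_differentiable.
  rewrite !deriveE//; last first.
    by apply/differentiable_comp => //; exact: linear_differentiable.
  rewrite diff_comp//; last exact: linear_differentiable.
  by rewrite /= diff_lin.
have cf_cont : {within `[0, 1], continuous (c i \o f)}.
  apply: derivable_within_continuous => t t01.
  by have [] := dcf t t01.
have dcf_oo (t : R) :
    t \in `]0, 1[ -> is_derive t (1 : R) (c i \o f) (c i (f' t)).
  by move=> /subset_itv_oo_cc /dcf.
have [t t01] :=
  @MVT_segment R (c i \o f) (c i \o f') 0 1 ler01 dcf_oo cf_cont.
rewrite subr0 mulr1 /= -linearB => ->.
by apply: le_trans (c_bound _ _) _; apply: ler_wpM2l => //; exact: f'M.
Qed.

End MeanValue.

(** * Taylor's formula and local Lipschitz continuity *)

Section Taylor.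
Variables (R : realType) (V W : normedModType R).
Hypotheses (fdV : finite_dimensional V) (fdW : finite_dimensional W).
Implicit Types (f : V -> W) (z w : V).

Lemma near0_star (P : V -> Prop) : (\forall w \near 0, P w) ->
  \forall w \near 0, forall t : R, t \in `[0, 1] -> P (t *: w).
Proof.
move=> /nbhs_ballP[d /= d0 dP]; apply/nbhs_ballP; exists d => //= w.
rewrite -ball_normE /= sub0r normrN => wd t.
rewrite in_itv/= => /andP[t0 t1]; apply: dP.
rewrite -ball_normE /= sub0r normrN normrZ ger0_norm//.
by apply: le_lt_trans wd; rewrite ler_piMl.
Qed.

Lemma continuous_near0_bounded f z : continuous f ->
  exists2 C, 0 <= C & \forall w \near 0, `|f (z + w)| <= C.
Proof.
move=> cf; exists (`|f z| + 1); first by rewrite addr_ge0.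
have /cvgrPdist_le/(_ 1 ltr01) : f (z + w) @[w --> 0] --> f z.
  have : z + w @[w --> (0 : V)] --> z + 0.
    by apply: cvgD; [exact: cvg_cst|exact: cvg_id].
  by rewrite addr0 => h; apply: continuous_cvg => //; exact: cf.
apply: filterS => w fw; rewrite -lerBlDl (le_trans (lerB_dist _ _))//.
by rewrite distrC.
Qed.

Definition taylor_remainder (f : V -> W) (q : nat) (z w : V) : W :=
  f (z + w) - \sum_(m < q) (m`!%:R)^-1 *: iter_diff f (nseq m w) z.

(** Differentiating the remainder along the ray through [w] lowers its order by
    one and replaces [f] by its derivative in the direction [w]. *)
Lemma is_derive_taylor_remainder f q z w (t : R) : smooth f ->
  is_derive t (1 : R) (fun u : R => taylor_remainder f q.+1 z (u *: w))
    (taylor_remainder (fun x => 'd f x w) q z (t *: w)).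
Proof.
move=> sf; rewrite /taylor_remainder.
pose term m (u : R) := u ^+ m *: ((m`!%:R)^-1 *: iter_diff f (nseq m w) z).
have -> : (fun u : R => f (z + u *: w) -
    \sum_(m < q.+1) (m`!%:R)^-1 *: iter_diff f (nseq m (u *: w)) z) =
    (fun u : R => f (z + u *: w)) - \sum_(m < q.+1) term m.
  apply/funext => u; rewrite !fctE fct_sumE; congr (_ - _).
  by apply: eq_bigr => m _; rewrite iter_diff_scale// /term !scalerA mulrC.
have dterm m : is_derive t (1 : R) (term m.+1)
    ((m`!%:R)^-1 *: iter_diff (fun x => 'd f x w) (nseq m (t *: w)) z).
  apply: is_derive_eq (is_derive_monomialZ _ _ _) _.
  rewrite iter_diff_scale; last exact: smooth_diff.
  rewrite !scalerA; congr (_ *: _); rewrite factS natrM invfM /=.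
  by field; rewrite nat1r !pnatr_eq0 -lt0n fact_gt0.
have dterm0 : is_derive t (1 : R) (term 0) 0.
  by apply: is_derive_eq (is_derive_monomialZ _ _ _) _; rewrite mul0r scale0r.
apply: is_deriveB; first exact/is_derive_line/smooth_differentiable.
rewrite big_ord_recl -[X in is_derive _ _ _ X]add0r.
by apply: is_deriveD; apply: is_derive_sum.
Qed.

Lemma taylor_remainder_sum (I : Type) (r : seq I) (k : I -> R) (f : I -> V -> W)
    q z w : (forall i, smooth (f i)) ->
  taylor_remainder (fun x => \sum_(i <- r) k i *: f i x) q z w =
  \sum_(i <- r) k i *: taylor_remainder (f i) q z w.
Proof.
move=> sf; rewrite /taylor_remainder.
under [RHS]eq_bigr do rewrite scalerBr; rewrite sumrB; congr (_ - _).
under [RHS]eq_bigr do rewrite scaler_sumr.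
rewrite exchange_big/=; apply: eq_bigr => m _.
rewrite iter_diff_sum// scaler_sumr; apply: eq_bigr => i _.
by rewrite !scalerA mulrC.
Qed.

(** Induction on [q] by the mean value inequality on the segment to [w]: the
    derivative along it is the remainder of [fun x => 'd f x w], a combination
    of the finitely many [fun x => 'd f x (e i)] with coefficients of size
    [`|w|], hence the bound is uniform in the direction. *)
Lemma taylor_bound f q z : smooth f -> exists2 C, 0 <= C &
  \forall w \near 0, `|taylor_remainder f q z w| <= C * `|w| ^+ q.
Proof.
have [n [e [c [B [B0 cE c_bound]]]]] := bounded_coordinates fdV.
have [K K0 mvi] := mean_value_inequality fdW.
elim: q f => [|q IH] f sf.
  have [C C0 fC] := continuous_near0_bounded z (smooth_continuous sf).
  exists C => //; apply: filterS fC => w.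
  by rewrite /taylor_remainder big_ord0 subr0 expr0 mulr1.
have /choice[C CP] : forall i : 'I_n, exists C, 0 <= C /\ \forall w \near 0,
    `|taylor_remainder (fun x => 'd f x (e i)) q z w| <= C * `|w| ^+ q.
  by move=> i; have [C ? ?] := IH _ (smooth_diff (e i) sf); exists C.
exists (K * \sum_(i < n) B * C i).
  by rewrite mulr_ge0// sumr_ge0// => i _; rewrite mulr_ge0//; case: (CP i).
have /near0_star : \forall w \near 0, forall i : 'I_n,
    `|taylor_remainder (fun x => 'd f x (e i)) q z w| <= C i * `|w| ^+ q.
  by apply: filter_forall => i; case: (CP i).
apply: filterS => w remC.
have := @mvi _ _ (\sum_(i < n) B * C i * `|w| ^+ q.+1)
  (fun t _ => is_derive_taylor_remainder q z w t sf).
rewrite scale0r scale1r.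
have -> : taylor_remainder f q.+1 z 0 = 0.
  rewrite /taylor_remainder addr0 big_ord_recl/= fact0 invr1 scale1r.
  rewrite big1 ?addr0 ?subrr// => i _.
  have -> : (fun x => 'd f x 0) = (fun=> 0).
    by apply/funext => x; rewrite linear0.
  by rewrite iter_diff0 scaler0.
rewrite subr0 -mulrA mulr_suml; apply => t t01.
rewrite (cE w) diff_sum_dir -(cE w) taylor_remainder_sum; last first.
  by move=> i; exact: smooth_diff.
apply: le_trans (ler_norm_sum _ _ _) _; apply: ler_sum => i _.
rewrite normrZ exprS mulrACA; apply: ler_pM => //.
apply: le_trans (remC t t01 i) _; have [Ci0 _] := CP i.
move: t01; rewrite in_itv/= => /andP[t0 t1].
rewrite ler_wpM2l// lerXn2r ?nnegrE// normrZ ger0_norm//.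
by rewrite ler_piMl.
Qed.

Lemma smooth_locally_lipschitz f z : smooth f -> exists2 L, 0 <= L &
  exists2 d : R, 0 < d & forall w1 w2, `|w1| < d -> `|w2| < d ->
    `|f (z + w1) - f (z + w2)| <= L * `|w1 - w2|.
Proof.
move=> sf.
have [n [e [c [B [B0 cE c_bound]]]]] := bounded_coordinates fdV.
have [K K0 mvi] := mean_value_inequality fdW.
have /choice[C CP] : forall i : 'I_n, exists C, 0 <= C /\ \forall w \near 0,
    `|'d f (z + w) (e i)| <= C.
  move=> i; have := smooth_continuous (smooth_diff (e i) sf).
  by move=> /(continuous_near0_bounded z)[C]; exists C.
have /nbhs_ballP[d /= d0 dC] : \forall w \near (0 : V), forall i : 'I_n,
    `|'d f (z + w) (e i)| <= C i.
  by apply: filter_forall => i; case: (CP i).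
exists (K * \sum_(i < n) B * C i).
  by rewrite mulr_ge0// sumr_ge0// => i _; rewrite mulr_ge0//; case: (CP i).
(* The segment from [w2] to [w1] stays within [`|w2| + `|w1 - w2| <= 3 * r] of
   the origin if both ends are within [r]. *)
exists (d / 3); first by rewrite divr_gt0.
move=> w1 w2 w1d w2d.
have := @mvi _ _ (\sum_(i < n) B * C i * `|w1 - w2|)
  (fun t _ => is_derive_line
    (smooth_differentiable (z + w2 + t *: (w1 - w2)) sf)).
rewrite scale0r scale1r addr0 -addrA [w2 + _]addrC subrK -mulrA mulr_suml.
apply => t; rewrite in_itv/= => /andP[t0 t1].
rewrite (cE (w1 - w2)) linear_sum -(cE (w1 - w2)).
apply: le_trans (ler_norm_sum _ _ _) _; apply: ler_sum => i _.
rewrite linearZ normrZ mulrAC; apply: ler_pM => //.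
rewrite -addrA; apply: dC; rewrite -ball_normE /= sub0r normrN.
apply: le_lt_trans (ler_normD _ _) _.
rewrite normrZ ger0_norm//.
apply: (@le_lt_trans _ _ (`|w2| + (`|w1| + `|w2|))).
  rewrite lerD2l; apply: le_trans (ler_normB _ _).
  by rewrite ler_piMl.
lra.
Qed.

End Taylor.

(** * Functions of order [h ^+ k] at the origin *)

Section OrderOfVanishing.
Variables (R : realType).
Implicit Types (V W : normedModType R).

Definition bigO_pow V (k : nat) (f : R -> V) : Prop :=
  exists2 C : R, 0 <= C & \forall h \near 0, `|f h| <= C * `|h| ^+ k.

Lemma bigO_pow_near V k (f g : R -> V) : (\forall h \near 0, f h = g h) ->
  bigO_pow k f -> bigO_pow k g.
Proof.
move=> fg [C C0 fC]; exists C => //.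
by apply: filterS2 fg fC => h ->.
Qed.

Lemma bigO_pow_ext V k (f g : R -> V) : f =1 g ->
  bigO_pow k f -> bigO_pow k g.
Proof. by move=> /funext ->. Qed.

Lemma bigO_powD V k (f g : R -> V) :
  bigO_pow k f -> bigO_pow k g -> bigO_pow k (fun h => f h + g h).
Proof.
move=> [C C0 fC] [D D0 gD]; exists (C + D); first exact: addr_ge0.
apply: filterS2 fC gD => h fC gD.
by rewrite mulrDl; apply: le_trans (ler_normD _ _) _; exact: lerD.
Qed.

Lemma bigO_powZ V k (a : R) (f : R -> V) :
  bigO_pow k f -> bigO_pow k (fun h => a *: f h).
Proof.
move=> [C C0 fC]; exists (`|a| * C); first exact: mulr_ge0.
by apply: filterS fC => h fC; rewrite normrZ -mulrA ler_wpM2l.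
Qed.

Lemma bigO_powB V k (f g : R -> V) :
  bigO_pow k f -> bigO_pow k g -> bigO_pow k (fun h => f h - g h).
Proof.
move=> fO gO; apply: bigO_pow_ext (bigO_powD fO (bigO_powZ (-1) gO)) => h.
  by rewrite scaleN1r.
Qed.

Lemma bigO_pow0 V k : bigO_pow k (fun=> 0 : V).
Proof. by exists 0 => //; apply: filterE => h; rewrite normr0 mul0r. Qed.

Lemma bigO_pow_sum V k (I : Type) (r : seq I) (f : I -> R -> V) :
  (forall i, bigO_pow k (f i)) -> bigO_pow k (fun h => \sum_(i <- r) f i h).
Proof.
move=> fO; elim: r => [|i r IH].
  by apply: bigO_pow_ext (bigO_pow0 V k) => h; rewrite big_nil.
by apply: bigO_pow_ext (bigO_powD (fO i) IH) => h; rewrite big_cons.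
Qed.

Lemma bigO_pow_mul V k m (f : R -> V) :
  bigO_pow k f -> bigO_pow (m + k) (fun h => h ^+ m *: f h).
Proof.
move=> [C C0 fC]; exists C => //; apply: filterS fC => h fC.
by rewrite normrZ normrX exprD mulrCA ler_wpM2l// exprn_ge0.
Qed.

Lemma bigO_pow_leq V k m (f : R -> V) : (k <= m)%N ->
  bigO_pow m f -> bigO_pow k f.
Proof.
move=> km [C C0 fC]; exists C => //.
have h1 : \forall h \near (0 : R), `|h| <= 1.
  apply/nbhs_ballP; exists 1 => //= h.
  by rewrite -ball_normE /= sub0r normrN => /ltW.
apply: filterS2 h1 fC => h h1 fC; apply: le_trans fC _.
by rewrite ler_wpM2l// ler_wiXn2l.
Qed.

Lemma bigO_pow_monomial V k m (w : V) : (k <= m)%N ->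
  bigO_pow k (fun h => h ^+ m *: w).
Proof.
move=> km; apply: (bigO_pow_leq km).
rewrite -[X in bigO_pow X]addn0; apply: (@bigO_pow_mul _ 0 m (fun=> w)).
exists `|w| => //; by apply: filterE => h; rewrite expr0 mulr1.
Qed.

Lemma bigO_pow_pair V W k (f : R -> V) (g : R -> W) :
  bigO_pow k f -> bigO_pow k g -> bigO_pow k (fun h => (f h, g h)).
Proof.
move=> [C C0 fC] [D D0 gD]; exists (C + D); first exact: addr_ge0.
apply: filterS2 fC gD => h fC gD; rewrite mulrDl prod_normE/= ge_max.
by rewrite (le_trans fC) ?lerDl ?mulr_ge0 ?exprn_ge0//
  (le_trans gD) ?lerDr ?mulr_ge0 ?exprn_ge0.
Qed.

Lemma bigO_pow1_near V (f : R -> V) (P : V -> Prop) : bigO_pow 1 f ->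
  (\forall w \near 0, P w) -> \forall h \near 0, P (f h).
Proof.
move=> [C C0 fC] /nbhs_ballP[d /= d0 dP].
have Cd : \forall h \near (0 : R), `|h| < d / (C + 1).
  apply/nbhs_ballP; exists (d / (C + 1)) => /=.
    by rewrite divr_gt0// ltr_wpDl.
  by move=> h; rewrite -ball_normE /= sub0r normrN.
apply: filterS2 Cd fC => h hd fC; apply: dP.
rewrite -ball_normE /= sub0r normrN; apply: le_lt_trans fC _.
rewrite expr1; apply: (@le_lt_trans _ _ ((C + 1) * `|h|)).
  by rewrite ler_wpM2r// lerDl.
by rewrite -ltr_pdivlMl 1?mulrC// ltr_wpDl.
Qed.

Lemma continuous_bigO_pow0 V (f : R -> V) :
  {for 0, continuous f} -> bigO_pow 0 f.
Proof.
move=> cf; exists (`|f 0| + 1); first by rewrite addr_ge0.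
have /cvgrPdist_le/(_ 1 ltr01) := cf.
apply: filterS => h fh; rewrite expr0 mulr1.
by rewrite -lerBlDl (le_trans (lerB_dist _ _))// distrC.
Qed.

Lemma bigO_pow_primitive W k (r r' : R -> W) : finite_dimensional W ->
  (\forall h \near 0, is_derive (h : R) (1 : R) r (r' h)) -> r 0 = 0 ->
  bigO_pow k r' -> bigO_pow k.+1 r.
Proof.
move=> fdW dr r0 [C C0 r'C].
have [K K0 mvi] := mean_value_inequality fdW.
exists (K * C); first exact: mulr_ge0.
apply: filterS2 (near0_star dr) (near0_star r'C) => h dr_h r'C_h.
have dline (t : R) : t \in `[0, 1] ->
    is_derive t (1 : R) (fun u : R => r (u *: h)) (h *: r' (t *: h)).
  by move=> /dr_h; exact: is_derive_dilate.
have := mvi _ _ (C * `|h| ^+ k.+1) dline.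
rewrite scale0r scale1r r0 subr0 mulrA; apply => t t01.
rewrite normrZ exprS mulrCA ler_wpM2l//.
apply: le_trans (r'C_h t t01) _; rewrite ler_wpM2l//.
move: t01; rewrite in_itv/= => /andP[t0 t1].
by rewrite lerXn2r ?nnegrE// normrZ ger0_norm// ler_piMl.
Qed.

End OrderOfVanishing.

(** * Expansions indexed by trees *)

Definition colored (r : seq ectree) : seq (ectree * color) :=
  [seq (t, a) | t <- r, a <- [:: Color1; Color2]].

(** A finite list of ordered trees containing those of order at most [q]; the
    further trees it contains have larger order and are absorbed by the
    remainders.  The recursion is the one by which an expansion of two curves up
    to [h ^+ q] yields the expansion of [F] along them. *)
Fixpoint trees (q : nat) : seq ectree :=
  if q is q'.+1 then
    [seq Node l | m <- iota 0 q, l <- words m (colored (trees q'))]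
  else [::].

Lemma treesS q : trees q.+1 =
  [seq Node l | m <- iota 0 q.+1, l <- words m (colored (trees q))].
Proof. by []. Qed.

(** Coefficient of a tree in the expansion of [F] along two curves, when the
    [a]-colored argument of [F] has coefficients [c a]. *)
Definition graft (R : realType) (c : color -> ectree -> R) (t : ectree) : R :=
  let: Node l := t in \prod_(x <- l) c x.2 x.1.

(** Taylor's formula weights a term by its degree [m], an elementary
    differential weights a node by its number of children; the two agree on
    words of length [m]. *)
Lemma big_words_size (V : nmodType) (I : Type) (r : seq I) m
    (G : nat -> seq I -> V) :
  \sum_(l <- words m r) G (size l) l = \sum_(l <- words m r) G m l.
Proof.
elim: m G => [|m IH] G /=; first by rewrite !big_seq1.
rewrite !big_allpairs_dep; apply: eq_bigr => i _ /=.
exact: (IH (fun n l => G n.+1 (i :: l))).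
Qed.

Lemma ectree_order_gt0 t : (0 < ectree_order t)%N.
Proof. by case: t. Qed.

Section BSeries.
Variables (R : realType) (X : normedModType R) (F : X * X -> X) (y0 : X).

Definition color_incl (a : color) (x : X) : X * X :=
  match a with Color1 => (x, 0) | Color2 => (0, x) end.

(** The elementary differential of an ordered tree, weighted by the product of
    the Taylor coefficients [1 / m!] over its nodes; the remaining combinatorial
    weight of an unordered tree arises from summing over its orderings. *)
Fixpoint elem_diff (t : ectree) : X :=
  let: Node l := t in
  ((size l)`!%:R)^-1 *:
    iter_diff F [seq color_incl c.2 (elem_diff c.1) | c <- l] (y0, y0).

Definition bseries (q : nat) (c : ectree -> R) (h : R) : X :=
  \sum_(t <- trees q) (h ^+ ectree_order t * c t) *: elem_diff t.

(** With coefficients [(ectree_order t)%:R * c t] this is the derivative of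
    [bseries q c]; with coefficients [graft c] it is the expansion of [F] along
    the curves expanded by [c]. *)
Definition bseries_deriv (q : nat) (c : ectree -> R) (h : R) : X :=
  \sum_(t <- trees q) (h ^+ (ectree_order t).-1 * c t) *: elem_diff t.

Definition colored_bseries (q : nat) (c : color -> ectree -> R) (h : R) :
    X * X :=
  \sum_(x <- colored (trees q)) (h ^+ ectree_order x.1 * c x.2 x.1) *:
    color_incl x.2 (elem_diff x.1).

Lemma colored_bseriesE q c h :
  colored_bseries q c h = (bseries q (c Color1) h, bseries q (c Color2) h).
Proof.
rewrite /colored_bseries /bseries big_allpairs_dep.
elim: (trees q) => [|t r IH]; first by rewrite !big_nil.
rewrite !big_cons IH !big_nil /= addr0.
by congr pair => /=; rewrite scaler0 ?addr0 ?add0r.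
Qed.

Lemma bigO_bseries q c : bigO_pow 1 (bseries q c).
Proof.
apply: bigO_pow_sum => t.
apply: bigO_pow_ext
  (bigO_pow_monomial (c t *: elem_diff t) (ectree_order_gt0 t)) => h.
  by rewrite scalerA.
Qed.

Hypotheses (fdX : finite_dimensional X) (sF : smooth F).

(** The Taylor polynomial of [F] at a sum over trees is a sum over trees: a word
    of length [m] in the colored trees is the list of subtrees of one tree, and
    the exponents of [h] along the word add up to the order of that tree without
    its root. *)
Lemma taylor_colored_bseries q c h :
  \sum_(m < q.+1) (m`!%:R)^-1 *:
    iter_diff F (nseq m (colored_bseries q c h)) (y0, y0) =
  bseries_deriv q.+1 (graft c) h.
Proof.
rewrite /bseries_deriv treesS big_allpairs_dep.
rewrite -(big_mkord xpredT (fun m => (m`!%:R)^-1 *: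
    iter_diff F (nseq m (colored_bseries q c h)) (y0, y0))) /index_iota subn0.
apply: eq_bigr => m _.
rewrite /colored_bseries iter_diff_multilinear// scaler_sumr /=.
rewrite -(big_words_size _ _ (fun m l => m`!%:R^-1 *:
  ((\prod_(i <- l) (h ^+ ectree_order i.1 * c i.2 i.1)) *:
    iter_diff F [seq color_incl i.2 (elem_diff i.1) | i <- l] (y0, y0)))).
apply: eq_bigr => l _; rewrite /= big_split/= big_map !scalerA mulrC.
by rewrite prodrXr.
Qed.

(** The truncated series may replace the actual curves inside [F] by the
    Lipschitz estimate, and there [F] may be replaced by its Taylor polynomial
    since the series vanishes at [h = 0]. *)
Lemma bseries_composition q (c : color -> ectree -> R) (u1 u2 : R -> X) :
  bigO_pow q.+1 (fun h => u1 h - y0 - bseries q (c Color1) h) ->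
  bigO_pow q.+1 (fun h => u2 h - y0 - bseries q (c Color2) h) ->
  bigO_pow q.+1 (fun h => F (u1 h, u2 h) - bseries_deriv q.+1 (graft c) h).
Proof.
move=> O1 O2; set z := (y0, y0).
pose w h := (u1 h - y0, u2 h - y0); pose w' := colored_bseries q c.
have w'O : bigO_pow 1 w'.
  apply: bigO_pow_ext (bigO_pow_pair (bigO_bseries q (c Color1))
    (bigO_bseries q (c Color2))) => h.
  by rewrite /w' colored_bseriesE.
have ww' : bigO_pow q.+1 (fun h => w h - w' h).
  apply: bigO_pow_ext (bigO_pow_pair O1 O2) => h.
  by rewrite /w' colored_bseriesE.
have wO : bigO_pow 1 w.
  apply: bigO_pow_ext (bigO_powD (bigO_pow_leq _ ww') w'O) => // h.
  by rewrite subrK.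
have fdXX := finite_dimensional_prod fdX fdX.
have lip : bigO_pow q.+1 (fun h => F (z + w h) - F (z + w' h)).
  have [L L0 [d d0 Lip]] := smooth_locally_lipschitz fdXX fdX z sF.
  have dball : \forall x \near (0 : X * X), `|x| < d.
    by apply/nbhs_ballP; exists d => //= x; rewrite -ball_normE /= sub0r normrN.
  have [C C0 ww'C] := ww'; exists (L * C); first exact: mulr_ge0.
  apply: filterS3 (bigO_pow1_near wO dball) (bigO_pow1_near w'O dball) ww'C.
  move=> h wd w'd ww'h; apply: le_trans (Lip _ _ wd w'd) _.
  by rewrite -mulrA ler_wpM2l.
have tay : bigO_pow q.+1 (fun h => taylor_remainder F q.+1 z (w' h)).
  have [C C0 remC] := taylor_bound fdXX fdX q.+1 z sF.
  have [D D0 w'D] := w'O; exists (C * D ^+ q.+1).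
    by rewrite mulr_ge0// exprn_ge0.
  apply: filterS2 (bigO_pow1_near w'O remC) w'D => h rem_h w'h.
  apply: le_trans rem_h _; rewrite -mulrA ler_wpM2l// -exprMn.
  by rewrite lerXn2r ?nnegrE ?mulr_ge0// -[X in _ * X]expr1.
apply: bigO_pow_ext (bigO_powD lip tay) => h.
rewrite /taylor_remainder taylor_colored_bseries addrA subrK.
by congr (F _ - _); rewrite /w /z; congr pair; rewrite /= addrC subrK.
Qed.

End BSeries.

(** * Expansions of the exact and numerical solutions *)

Section Expansions.
Variables (R : realType) (X : normedModType R) (F : X * X -> X) (y0 : X).
Hypotheses (fdX : finite_dimensional X) (sF : smooth F).

Lemma bseries0 q (c : ectree -> R) : bseries F y0 q c 0 = 0.
Proof.
rewrite /bseries big1 // => t _.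
by rewrite expr0n gtn_eqF ?ectree_order_gt0// mul0r scale0r.
Qed.

Lemma is_derive_bseries q (c : ectree -> R) (h : R) :
  is_derive h (1 : R) (bseries F y0 q c)
    (bseries_deriv F y0 q (fun t => (ectree_order t)%:R * c t) h).
Proof.
rewrite /bseries /bseries_deriv; elim: (trees q) => [|t r IH].
  rewrite big_nil; under eq_fun do rewrite big_nil; exact: is_derive_cst.
rewrite big_cons; under eq_fun do rewrite big_cons.
apply: is_deriveD.
have -> : (fun u : R => (u ^+ ectree_order t * c t) *: elem_diff F y0 t) =
    (fun u : R => u ^+ ectree_order t *: (c t *: elem_diff F y0 t)).
  by apply/funext => u; rewrite scalerA.
apply: is_derive_eq (is_derive_monomialZ _ _ _) _.
by rewrite scalerA; congr (_ *: _); ring.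
Qed.

Lemma bseries_deriv_eq q (c d : ectree -> R) h : c =1 d ->
  bseries_deriv F y0 q c h = bseries_deriv F y0 q d h.
Proof. by move=> cd; apply: eq_bigr => t _; rewrite cd. Qed.

Section Exact.
Variables (t0 : R) (y : R -> X).
Hypothesis y_sol : exact_solution F t0 y0 y.

Let inv_density (t : ectree) : R := (density t)%:R^-1.

(** The recursion of the density is the differential equation read on
    coefficients. *)
Lemma graft_inv_density t :
  graft (fun=> inv_density) t = (ectree_order t)%:R * inv_density t.
Proof.
case: t => l; rewrite /inv_density.
have -> : density (Node l) =
    (ectree_order (Node l) * \prod_(n <- [seq density c.1 | c <- l]) n)%N by [].
rewrite big_map natrM invfM mulrA divff; last first.
  by rewrite pnatr_eq0 -lt0n ectree_order_gt0.
by rewrite mul1r /= natr_prod prodfV.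
Qed.

(** Picard iteration: an expansion of [y] gives one of [F (y, y)], and
    integrating it gains one order. *)
Lemma exact_bseries q :
  bigO_pow q.+1 (fun h => y (t0 + h) - y0 - bseries F y0 q inv_density h).
Proof.
have [yt0 dy] := y_sol.
have dz : \forall h \near (0 : R),
    is_derive h (1 : R) (fun u => y (t0 + u)) (F (y (t0 + h), y (t0 + h))).
  have t0h : t0 + h @[h --> (0 : R)] --> t0.
    rewrite -[X in _ --> X]addr0.
    by apply: cvgD; [exact: cvg_cst|exact: cvg_id].
  have : \forall h \near (0 : R),
      is_derive (t0 + h) (1 : R) y (F (y (t0 + h), y (t0 + h))).
    exact: t0h dy.
  by apply: filterS => h; exact: is_derive_translate.
have primitive k n :
  bigO_pow k (fun h => F (y (t0 + h), y (t0 + h)) -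
    bseries_deriv F y0 n (graft (fun=> inv_density)) h) ->
  bigO_pow k.+1 (fun h => y (t0 + h) - y0 - bseries F y0 n inv_density h).
  apply: bigO_pow_primitive => //; last first.
    by rewrite addr0 yt0 subrr bseries0 subr0.
  apply: filterS dz => h dz_h.
  rewrite (bseries_deriv_eq _ _ graft_inv_density).
  apply: is_deriveB; last exact: is_derive_bseries.
  apply: is_derive_eq (is_deriveB dz_h (is_derive_cst y0 h 1)) _.
  by rewrite subr0.
elim: q => [|q IH]; last exact/primitive/bseries_composition.
apply: primitive.
apply: (@bigO_pow_ext _ _ _ (fun h => F (y (t0 + h), y (t0 + h)))) => [h|].
  by rewrite /bseries_deriv big_nil subr0.
apply: continuous_bigO_pow0.
have cz : {for 0, continuous (fun h => y (t0 + h))}.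
  have [/derivable1_diffP dz0 _] := nbhs_singleton dz.
  exact: differentiable_continuous.
apply: (@continuous_comp _ _ _ (fun h => (y (t0 + h), y (t0 + h))) F).
  exact: cvg_pair.
exact: smooth_continuous.
Qed.

End Exact.

Section Numerical.
Variables (s : nat) (a : 'I_s -> 'I_s -> 'I_s -> R) (Y : 'I_s -> R -> X).
Hypothesis Y_sol : stage_solution a F y0 Y.

(** Stage [i] is the quadrature with weights [a i], so its coefficients are
    [Phi a (a i)]; grafting them is the recursion that defines [phi]. *)
Lemma graft_stage_weight j k t :
  graft (fun col => Phi a (a (pick_index col j k))) t = phi a t j k.
Proof. by case: t => l; rewrite /= big_map. Qed.

(** The factor [h] of the step accounts for the root of each tree. *)
Lemma quadrature_bseries n q (b : 'I_s -> 'I_s -> R) :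
  (forall j k, bigO_pow n (fun h => F (Y j h, Y k h) -
    bseries_deriv F y0 q (fun t => phi a t j k) h)) ->
  bigO_pow n.+1 (fun h =>
    h *: (\sum_(j < s) \sum_(k < s) b j k *: F (Y j h, Y k h)) -
    bseries F y0 q (Phi a b) h).
Proof.
move=> O_F.
have : bigO_pow n (fun h => \sum_(j < s) \sum_(k < s) b j k *:
    (F (Y j h, Y k h) - bseries_deriv F y0 q (fun t => phi a t j k) h)).
  by do 2!apply: bigO_pow_sum => ?; exact: bigO_powZ.
move=> /(@bigO_pow_mul _ _ _ 1); apply: bigO_pow_ext => h.
rewrite expr1.
under eq_bigr do under eq_bigr do rewrite scalerBr.
under eq_bigr do rewrite sumrB.
rewrite sumrB scalerBr; congr (_ - _).
rewrite /bseries_deriv /bseries.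
under eq_bigr do under eq_bigr do rewrite scaler_sumr.
under eq_bigr do rewrite exchange_big.
rewrite exchange_big scaler_sumr; apply: eq_bigr => t _ /=.
rewrite /Phi mulr_sumr scaler_suml scaler_sumr; apply: eq_bigr => j _.
rewrite mulr_sumr scaler_suml scaler_sumr; apply: eq_bigr => k _.
rewrite !scalerA; congr (_ *: _).
by rewrite -[in RHS](prednK (ectree_order_gt0 t)) exprS; ring.
Qed.

(** Each use of the stage equations multiplies by [h] and so gains one order,
    starting from the boundedness of [F] along the continuous stages. *)
Lemma stage_values_bseries q j k : bigO_pow q.+1 (fun h => F (Y j h, Y k h) -
  bseries_deriv F y0 q.+1 (fun t => phi a t j k) h).
Proof.
have [Y0 Yeq] := Y_sol.
have stage n m i :
  (forall j k, bigO_pow n (fun h => F (Y j h, Y k h) -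
    bseries_deriv F y0 m (fun t => phi a t j k) h)) ->
  bigO_pow n.+1 (fun h => Y i h - y0 - bseries F y0 m (Phi a (a i)) h).
  move=> /(quadrature_bseries (a i)); apply: bigO_pow_near.
  by apply: filterS Yeq => h ->; rewrite [y0 + _]addrC addrK.
have values n : (forall i, bigO_pow n.+1 (fun h =>
    Y i h - y0 - bseries F y0 n (Phi a (a i)) h)) ->
  forall j k, bigO_pow n.+1 (fun h => F (Y j h, Y k h) -
    bseries_deriv F y0 n.+1 (fun t => phi a t j k) h).
  move=> O_Y i l.
  have := @bseries_composition _ _ _ y0 fdX sF n
    (fun col => Phi a (a (pick_index col i l))) _ _ (O_Y i) (O_Y l).
  apply: bigO_pow_ext => h.
  by rewrite (bseries_deriv_eq _ _ (graft_stage_weight i l)).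
elim: q j k => [|q IH]; apply: values => i; apply: stage => // j k.
apply: (@bigO_pow_ext _ _ _ (fun h => F (Y j h, Y k h))) => [h|].
  by rewrite /bseries_deriv big_nil subr0.
apply: continuous_bigO_pow0.
apply: (@continuous_comp _ _ _ (fun h => (Y j h, Y k h)) F).
  by apply: cvg_pair; [case: (Y0 j)|case: (Y0 k)].
exact: smooth_continuous.
Qed.

Lemma nprk_step_bseries q (b : 'I_s -> 'I_s -> R) :
  bigO_pow q.+2 (fun h =>
    nprk_step b F y0 Y h - y0 - bseries F y0 q.+1 (Phi a b) h).
Proof.
apply: bigO_pow_ext (quadrature_bseries b (stage_values_bseries q)) => h.
by rewrite /nprk_step [y0 + _]addrC addrK.
Qed.

End Numerical.

End Expansions.

Lemma order_conditions_sufficient (R : realType) (s p : nat)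
    (a : 'I_s -> 'I_s -> 'I_s -> R) (b : 'I_s -> 'I_s -> R) :
  (forall t, (ectree_order t <= p)%N -> Phi a b t = 1 / (density t)%:R) ->
  nprk_has_order a b p.
Proof.
move=> cond X F t0 y0 y Y fdX sF y_sol Y_sol.
have O_diff : bigO_pow p.+1 (fun h => nprk_step b F y0 Y h - y (t0 + h)).
  have O_num := bigO_pow_leq (leqnSn _) (nprk_step_bseries fdX sF Y_sol p b).
  have O_ex := bigO_pow_leq (leqnSn _) (exact_bseries fdX sF y_sol p.+1).
  have O_series : bigO_pow p.+1 (fun h => bseries F y0 p.+1 (Phi a b) h -
      bseries F y0 p.+1 (fun t => (density t)%:R^-1) h).
    apply: (@bigO_pow_ext _ _ _ (fun h => \sum_(t <- trees p.+1)
        h ^+ ectree_order t *: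
          ((Phi a b t - (density t)%:R^-1) *: elem_diff F y0 t))).
      move=> h; rewrite /bseries -sumrB; apply: eq_bigr => t _.
      by rewrite scalerA mulrBr scalerBl.
    apply: bigO_pow_sum => t; have [tp|tp] := leqP (ectree_order t) p.
      apply: bigO_pow_ext (bigO_pow0 _ _) => h.
      by rewrite cond// div1r subrr scale0r scaler0.
    exact: bigO_pow_monomial.
  apply: bigO_pow_ext (bigO_powD (bigO_powB O_num O_ex) O_series) => h.
  rewrite opprB addrACA subrK [X in _ + (X - _)]addrC addrK.
  by rewrite opprB addrA subrK.
have [C C0 diffC] := O_diff.
apply/eqO_exP; exists (C + 1); first by rewrite ltr_wpDl.
apply: filterS diffC => h /le_trans; apply.
by rewrite normrX ler_wpM2r ?exprn_ge0// lerDl.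
Qed.

(** * Smooth functions into row vectors *)

Section SmoothFunctions.
Variables (R : realType) (V W : normedModType R).

Lemma class_CS n (f : V -> W) : class_C n.+1 f -> class_C n f.
Proof.
elim: n f => [|n IH] f [df cf].
  by move=> x; exact: differentiable_continuous.
by split=> // v; apply: IH; exact: cf.
Qed.

Lemma class_C_Zl n (f : V -> R) (w : W) : class_C n f ->
  class_C n (fun x => f x *: w).
Proof.
elim: n f => [|n IH] f /=.
  by move=> cf x; apply: cvgZr_tmp; exact: cf.
move=> [df cf]; split=> [x|v]; first exact: differentiableZl.
under eq_fun do rewrite diffZl//.
exact: IH.
Qed.

Lemma class_C_linear n (f : {linear V -> W}) : continuous f -> class_C n f.
Proof.
move=> cf; case: n => [//|n]; split=> [x|v]; first exact: linear_differentiable.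
under eq_fun do rewrite diff_lin//.
exact: class_C_cst.
Qed.

End SmoothFunctions.

Section SmoothProducts.
Variables (R : realType) (V : normedModType R).

Lemma class_C_mul n (f g : V -> R) : class_C n f -> class_C n g ->
  class_C n (fun x => f x * g x).
Proof.
elim: n f g => [|n IH] f g.
  by move=> cf cg x; apply: cvgM; [exact: cf|exact: cg].
move=> Cf Cg; have [df cf] := Cf; have [dg cg] := Cg.
split=> [x|v]; first exact: (@differentiableM _ _ f g).
have -> : (fun x => 'd (fun y => f y * g y) x v) =
    (fun x => 1 *: (f x * 'd g x v) + g x * 'd f x v).
  apply/funext => x; rewrite scale1r.
  have := congr1 (fun L : V -> R => L v) (diffM (df x) (dg x)).
  by rewrite !fctE.
apply: (@class_C_lincomb _ _ R^o n
  (fun x => f x * 'd g x v) (fun x => g x * 'd f x v)).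
  by apply: IH; [exact: class_CS|exact: cg].
by apply: IH; [exact: class_CS|exact: cf].
Qed.

Lemma class_C_prod n (I : Type) (r : seq I) (f : I -> V -> R) :
  (forall i, class_C n (f i)) -> class_C n (fun x => \prod_(i <- r) f i x).
Proof.
move=> cf; elim: r => [|i r IH].
  by under eq_fun do rewrite big_nil; exact: class_C_cst.
by under eq_fun do rewrite big_cons; exact: class_C_mul.
Qed.

End SmoothProducts.

Section RowVectors.
Variables (R : realType) (N : nat).

Lemma finite_dimensional_rV : finite_dimensional 'rV[R]_N.
Proof.
exists N, (fun i => delta_mx ord0 i) => x; exists (fun i => x ord0 i).
exact: row_sum_delta.
Qed.

Lemma class_C_row (V : normedModType R) n (f : 'I_N -> V -> R) :
  (forall i, class_C n (f i)) -> class_C n (fun x => \row_i f i x).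
Proof.
move=> cf.
have -> : (fun x => \row_i f i x) =
    (fun x => \sum_(i < N) 1 *: (f i x *: delta_mx ord0 i)).
  apply/funext => x; rewrite [LHS]row_sum_delta; apply: eq_bigr => i _.
  by rewrite mxE scale1r.
by apply: class_C_sum => i; exact: class_C_Zl.
Qed.

Lemma is_derive_row (f : 'I_N -> R -> R) (t : R) (d : 'I_N -> R) :
  (forall i, is_derive t (1 : R) (f i) (d i)) ->
  is_derive t (1 : R) (fun u => \row_i f i u) (\row_i d i).
Proof.
move=> df.
have fE i j : (fun u => (\row_i f i u) i j) = f j.
  by apply/funext => u; rewrite mxE.
have derf : derivable (fun u => \row_i f i u) t 1.
  by apply/derivable_mxP => i j; rewrite fE; have [] := df j.
apply: DeriveDef => //; rewrite derive_mx//; apply/rowP => j.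
by rewrite !mxE fE; have [] := df j.
Qed.

Lemma class_C_coord n a j :
  class_C n (fun z : 'rV[R]_N * 'rV[R]_N => pick_index a z.1 z.2 ord0 j).
Proof.
pose L (z : 'rV[R]_N * 'rV[R]_N) : R^o := pick_index a z.1 z.2 ord0 j.
have L_lin : linear L by move=> k x x'; rewrite /L; case: (a); rewrite /= !mxE.
have cL : continuous L.
  move=> x; rewrite /L; case: (a) => /=.
    by apply: (@continuous_comp _ _ _ fst (fun M : 'rV[R]_N => M ord0 j));
      [exact: cvg_fst|exact: coord_continuous].
  by apply: (@continuous_comp _ _ _ snd (fun M : 'rV[R]_N => M ord0 j));
    [exact: cvg_snd|exact: coord_continuous].
pose L' : {linear ('rV[R]_N * 'rV[R]_N)%type -> R^o} :=
  HB.pack L (GRing.isLinear.Build R _ R^o _ _ L_lin).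
exact: (@class_C_linear _ _ _ n L').
Qed.

End RowVectors.

(** * A system of differential equations attached to a tree *)

(* Equality tests, for looking up a tree in a list of subtrees. *)
HB.instance Definition _ := gen_eqMixin color.
HB.instance Definition _ := gen_eqMixin ectree.

Definition children (t : ectree) : seq (ectree * color) :=
  let: Node l := t in l.

Lemma ectree_ind_children (P : ectree -> Prop) :
  (forall t, (forall c, c \in children t -> P c.1) -> P t) -> forall t, P t.
Proof.
move=> IH; fix rec 1; case=> l; apply: IH => /=.
elim: l => [|[t a] l IHl] c.
  rewrite in_nil; case/notF.
rewrite in_cons; case/predU1P => [->|]; [exact: (rec t)|exact: IHl].
Qed.

Fixpoint subtrees (t : ectree) : seq ectree :=
  let: Node l := t in t :: flatten [seq subtrees c.1 | c <- l].

Lemma subtrees_refl t : t \in subtrees t.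
Proof. by case: t => l /=; rewrite inE eqxx. Qed.

Lemma subtrees_children t u c :
  u \in subtrees t -> c \in children u -> c.1 \in subtrees t.
Proof.
elim/ectree_ind_children: t => -[l] IH /=; rewrite inE => /predU1P[->|] cu.
  rewrite inE; apply/orP; right; apply/flatten_mapP; exists c => //.
  exact: subtrees_refl.
move=> c_u; rewrite inE; apply/orP; right.
have /flatten_mapP[d dl du] := cu.
by apply/flatten_mapP; exists d => //; exact: (IH d).
Qed.

Section TreeSystem.
Variables (R : realType) (root : ectree).
Let r := subtrees root.

Definition slot (t : ectree) : 'I_(size r).+1 := inord (index t r).
(** The list of subtrees may repeat a tree, whose occurrences then satisfy the
    same equation.  The last index is the default of [inord]; it carries the
    single node, so that every index is equipped with an equation. *)
Definition tree_at (i : 'I_(size r).+1) : ectree := nth (Node [::]) r i.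

Lemma slotK t : t \in r -> tree_at (slot t) = t.
Proof.
by move=> tr; rewrite /tree_at inordK ?nth_index// ltnS ltnW// index_mem.
Qed.

Lemma tree_at_children i c : c \in children (tree_at i) -> c.1 \in r.
Proof.
have [i_r|r_i] := ltnP i (size r); last by rewrite /tree_at nth_default.
by apply: subtrees_children; exact: mem_nth.
Qed.

Let X := 'rV[R]_(size r).+1.

(** Built so that the recursions of [density] and [phi] solve the system
    exactly, each component being a monomial in the step size. *)
Definition tree_field (z : X * X) : X :=
  \row_i \prod_(c <- children (tree_at i))
    pick_index c.2 z.1 z.2 ord0 (slot c.1).

Lemma smooth_tree_field : smooth tree_field.
Proof.
move=> n; apply: class_C_row => i; apply: class_C_prod => c.
exact: class_C_coord.
Qed.

Definition tree_curve (w : ectree -> R) (h : R) : X :=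
  \row_i (h ^+ ectree_order (tree_at i) * w (tree_at i)).

Lemma order_children t :
  ((ectree_order t).-1 = \sum_(c <- children t) ectree_order c.1)%N.
Proof. by case: t => l; rewrite /= big_map. Qed.

(** Since the field is triangular and multiplicative, curves with monomial
    components are mapped to such curves: no remainder appears. *)
Lemma tree_field_curve (w : color -> ectree -> R) h :
  tree_field (tree_curve (w Color1) h, tree_curve (w Color2) h) =
  \row_i (h ^+ (ectree_order (tree_at i)).-1 * graft w (tree_at i)).
Proof.
apply/rowP => i; rewrite !mxE order_children -prodrXr.
have -> : graft w (tree_at i) = \prod_(c <- children (tree_at i)) w c.2 c.1.
  by case: (tree_at i).
rewrite -big_split /= big_seq [RHS]big_seq.
apply: eq_bigr => c /tree_at_children c_r.
by case: c.2; rewrite /= mxE slotK.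
Qed.

Lemma tree_curve0 w : tree_curve w 0 = 0.
Proof.
apply/rowP => i; rewrite !mxE expr0n gtn_eqF ?mul0r//; exact: ectree_order_gt0.
Qed.

Lemma is_derive_tree_curve w (h : R) : is_derive h (1 : R) (tree_curve w)
  (\row_i (h ^+ (ectree_order (tree_at i)).-1 *
    ((ectree_order (tree_at i))%:R * w (tree_at i)))).
Proof.
apply: is_derive_row => i; set n := ectree_order _; set k := w _.
have -> : (fun u : R => u ^+ n * k) = (fun u : R => k *: u ^+ n).
  by apply/funext => u; rewrite mulrC.
apply: is_derive_eq (is_deriveZ k (is_derive_monomial n h)) _.
by rewrite /GRing.scale/=; ring.
Qed.

Lemma tree_exact_solution :
  exact_solution tree_field 0 0 (tree_curve (fun t => (density t)%:R^-1)).
Proof.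
split; first exact: tree_curve0.
apply: filterE => h; apply: is_derive_eq (is_derive_tree_curve _ h) _.
have -> := tree_field_curve (fun=> (fun t => (density t)%:R^-1)) h.
apply/rowP => i; rewrite !mxE.
by rewrite graft_inv_density.
Qed.

Variables (s : nat) (a : 'I_s -> 'I_s -> 'I_s -> R).

Let stage (i : 'I_s) := tree_curve (Phi a (a i)).

Lemma tree_quadrature (b : 'I_s -> 'I_s -> R) h :
  h *: (\sum_(j < s) \sum_(k < s) b j k *: tree_field (stage j h, stage k h)) =
  tree_curve (Phi a b) h.
Proof.
apply/rowP => i; rewrite !mxE summxE /Phi !mulr_sumr; apply: eq_bigr => j _.
rewrite summxE !mulr_sumr; apply: eq_bigr => k _.
have -> := tree_field_curve (fun col => Phi a (a (pick_index col j k))) h.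
rewrite !mxE.
rewrite graft_stage_weight -[in RHS](prednK (ectree_order_gt0 _)) exprS; ring.
Qed.

Lemma tree_stage_solution : stage_solution a tree_field 0 stage.
Proof.
split=> [i|].
  split; first exact: tree_curve0.
  apply: differentiable_continuous; apply/derivable1_diffP.
  by have [] := is_derive_tree_curve (Phi a (a i)) 0.
by apply: filterE => h i; rewrite add0r tree_quadrature.
Qed.

End TreeSystem.

(** In the component of [t] the error of one step is exactly
    [(Phi a b t - 1 / density t) * h ^+ ectree_order t], which is
    [O(h ^+ p.+1)] only if the coefficient vanishes. *)
Lemma order_conditions_necessary (R : realType) (s p : nat)
    (a : 'I_s -> 'I_s -> 'I_s -> R) (b : 'I_s -> 'I_s -> R) (t : ectree) :
  nprk_has_order a b p -> (ectree_order t <= p)%N ->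
  Phi a b t = 1 / (density t)%:R.
Proof.
move=> ord_p t_p.
have := ord_p _ _ 0 0 _ _ (finite_dimensional_rV R _) (@smooth_tree_field R t)
  (tree_exact_solution R t) (tree_stage_solution t a).
move=> /eqO_exP[k k0 /nbhs_ballP[d /= d0 dk]].
apply/eqP; rewrite div1r -subr_eq0; apply/negPn/negP => gap0.
set D := Phi a b t - (density t)%:R^-1 in gap0 *.
have D0 : 0 < `|D| by rewrite normr_gt0.
(* A step inside the neighborhood [d], at most [1], and small enough for the
   bound [k * h] to fall below the gap. *)
pose h : R := Num.min (d / 2) (Num.min 1 (`|D| / (2 * k))).
have h0 : 0 < h by rewrite !lt_min !divr_gt0// ?mulr_gt0// ltr01.
have hd : h < d.
  by apply: (@le_lt_trans _ _ (d / 2)); [rewrite ge_min lexx|lra].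
have h1 : h <= 1 by rewrite !ge_min lexx orbT.
have hD : k * h < `|D|.
  apply: (@le_lt_trans _ _ (k * (`|D| / (2 * k)))).
    by apply: ler_wpM2l; [exact: ltW|rewrite !ge_min lexx !orbT].
  rewrite (_ : k * _ = `|D| / 2); first by lra.
  by field; rewrite gt_eqF.
have := dk h; rewrite -ball_normE /= sub0r normrN gtr0_norm// => /(_ hd).
rewrite /nprk_step add0r add0r tree_quadrature => Dk.
have : h ^+ ectree_order t * `|D| <= k * h ^+ p.+1.
  apply: le_trans (le_trans _ Dk) _; last by rewrite normrX gtr0_norm.
  rewrite /Num.norm/= mx_normrE.
  apply: le_trans (le_bigmax _ _ (ord0, slot t t)).
  rewrite !mxE slotK ?subtrees_refl// -mulrBr normrM normrX gtr0_norm//.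
have -> : p.+1 = (ectree_order t + (p - ectree_order t).+1)%N.
  by rewrite addnS subnKC.
rewrite exprD mulrCA ler_pM2l ?exprn_gt0// => Dkh.
suff : `|D| < `|D| by rewrite ltxx.
apply: le_lt_trans Dkh (le_lt_trans _ hD).
apply: ler_wpM2l; first exact: ltW.
by rewrite exprS ler_piMr ?(ltW h0)// exprn_ile1// ltW.
Qed.

Theorem theorem3p1 (R : realType) (s p : nat)
    (a : 'I_s -> 'I_s -> 'I_s -> R) (b : 'I_s -> 'I_s -> R) :
  nprk_has_order a b p <->
  (forall t : ectree, (ectree_order t <= p)%N ->
     Phi a b t = 1 / (density t)%:R).
Proof.
split=> [ord_p t|]; first exact: order_conditions_necessary.
exact: order_conditions_sufficient.
Qed.
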